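(* Let $X$ be a (real or complex) Banach space. Then the functions $\delta\longmapsto\Phi_X(\delta)$ and $\delta\longmapsto\Phi_X^S(\delta)$ are continuous in $(0,2)$.
   Context: For a (real or complex) Banach space $X\neq\{0\}$, $B_X$ and $S_X$ denote its closed unit ball and unit sphere, $X^*$ its topological dual, and $\Pi(X):=\{(x,x^* )\in X\times X^* : \|x\|=\|x^*\|=x^*(x)=1\}$. The Bishop-Phelps-Bollobás modulus $\Phi_X:(0,2)\to[0,\infty)$ is defined as follows: $\Phi_X(\delta)$ is the infimum of those $\varepsilon>0$ such that for every $(x,x^* )\in B_X\times B_{X^*}$ with $\operatorname{Re} x^*(x)>1-\delta$ there is $(y,y^* )\in\Pi(X)$ with $\|x-y\|<\varepsilon$ and $\|x^*-y^*\|<\varepsilon$. The spherical Bishop-Phelps-Bollobás modulus $\Phi_X^S:(0,2)\to[0,\infty)$ is defined in the same way with $B_X\times B_{X^*}$ replaced by $S_X\times S_{X^*}$. Banach spaces are assumed non-zero. *)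

(* Defs.v *)
From HB Require Import structures.
From mathcomp Require Export all_boot all_order all_algebra.
From mathcomp Require Export all_classical all_reals all_analysis.
From mathcomp Require Export complex.
Export numFieldNormedType.Exports.

Set Implicit Arguments.
Unset Strict Implicit.
Unset Printing Implicit Defensive.

Import Order.TTheory GRing.Theory Num.Theory.

Local Open Scope classical_set_scope.
Local Open Scope ring_scope.

(* The scalar field K is meant to be either R itself, with re := idfun, or R[i],
   with re := complex.Re.  The norm of a normedModType K is K-valued, and its
   values are real, so that re `|x| is the norm of x as an element of R. *)
Section BishopPhelpsBollobas.
Context (R : realType) (K : numFieldType) (re : K -> R).
Context (X : normedModType K).

Local Notation functional := {linear X -> K^o}.

Definition unit_ball : set X := [set x | `|x| <= 1].
Definition unit_sphere : set X := [set x | `|x| = 1].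

Definition dual : set functional := [set f | continuous f].

Definition dual_norm (f : X -> K^o) : R :=
  sup [set re `|f x| | x in unit_ball].

Definition dual_ball : set functional :=
  [set f | dual f /\ dual_norm f <= 1].
Definition dual_sphere : set functional :=
  [set f | dual f /\ dual_norm f = 1].

Definition norming_pairs : set (X * functional) :=
  [set p | unit_sphere p.1 /\ dual_sphere p.2 /\ p.2 p.1 = 1].

Definition bpb_approximable (A : set (X * functional)) (delta eps : R) : Prop :=
  forall (x : X) (f : functional), A (x, f) -> 1 - delta < re (f x) ->
  exists (y : X) (g : functional), norming_pairs (y, g) /\
    re `|x - y| < eps /\ dual_norm (f \- g) < eps.

Definition bpb_modulus_on (A : set (X * functional)) (delta : R) : R :=
  inf [set eps | 0 < eps /\ bpb_approximable A delta eps].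

Definition bpb_modulus : R -> R := bpb_modulus_on (unit_ball `*` dual_ball).

Definition spherical_bpb_modulus : R -> R :=
  bpb_modulus_on (unit_sphere `*` dual_sphere).

End BishopPhelpsBollobas.

Arguments bpb_modulus {R K} re X.
Arguments spherical_bpb_modulus {R K} re X.

(* Main.v *)
Require Import Defs.
From mathcomp Require Import lra.

Set Implicit Arguments.
Unset Strict Implicit.
Unset Printing Implicit Defensive.

Import Order.TTheory GRing.Theory Num.Theory.

Local Open Scope classical_set_scope.
Local Open Scope ring_scope.

(* The modulus at delta is the supremum of the distances to the norming pairs of
   the pairs (x, f) of A with Re f(x) > 1 - delta.  Since it is nondecreasing in
   delta, and the distance is 1-Lipschitz, it is enough to show that any such pair
   is close to a pair in A at which Re f(x) is larger by a fixed amount.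

   On spheres, replace x by (x + s w) / |x + s w|, where w nearly norms f: the
   gain is of order s as long as |Re f(x)| is bounded away from 1.

   On balls, if the norm of f is close to 1, move x towards such a w.  Otherwise
   add to f a multiple of a fixed functional of norm 1, so that f has norm at
   least s / 2; then either Re f(x) is at least s / 8, and multiplying f by 1 + s
   increases it, or else moving x towards w does.  The gain is of order s^2. *)

(* Treats the real and the complex case uniformly. *)
Record real_part (R : realType) (K : numFieldType)
    (re : K -> R) (iota : {rmorphism R -> K}) : Prop := RealPart {
  reD : forall x y, re (x + y) = re x + re y;
  reM : forall a x, re (iota a * x) = a * re x;
  nneg_re : forall x, 0 <= x -> iota (re x) = x;
  iota_ge0 : forall a, 0 <= a -> 0 <= iota a;
  le_re : forall x y, x <= y -> re x <= re y }.

(** * Real scalars inside [K] and norms with values in [R] *)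

Section Modulus.
Context (R : realType) (K : numFieldType) (re : K -> R).
Context (iota : {rmorphism R -> K}) (H : real_part re iota).

Lemma re1 : re 1 = 1.
Proof. by apply: (fmorph_inj iota); rewrite rmorph1 (nneg_re H). Qed.

Lemma iotaK a : re (iota a) = a.
Proof. by rewrite -[iota a]mulr1 (reM H) re1 mulr1. Qed.

Lemma re0 : re 0 = 0.
Proof. by rewrite -(rmorph0 iota) iotaK. Qed.

Lemma le_iota a b : a <= b -> iota a <= iota b.
Proof. by move=> ab; rewrite -subr_ge0 -rmorphB (iota_ge0 H)// subr_ge0. Qed.

Lemma norm_iota a : `|iota a| = iota `|a|.
Proof.
have [a0|/ltW a0] := leP 0 a; first by rewrite (ger0_norm a0) ger0_norm// (iota_ge0 H).
by rewrite (ler0_norm a0) -normrN -rmorphN ger0_norm// (iota_ge0 H)// oppr_ge0.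
Qed.

Section Norm.
Context (V : normedModType K).
Implicit Types x y : V.

Lemma norm_re x : `|x| = iota (re `|x|).
Proof. by rewrite (nneg_re H). Qed.

Lemma re_norm_ge0 x : 0 <= re `|x|.
Proof. by rewrite -re0 (le_re H). Qed.

Lemma re_normD x y : re `|x + y| <= re `|x| + re `|y|.
Proof. by rewrite -(reD H) (le_re H)// ler_normD. Qed.

Lemma re_normZ a x : re `|iota a *: x| = `|a| * re `|x|.
Proof. by rewrite normrZ norm_iota (reM H). Qed.

Lemma unit_ballE x : unit_ball x <-> re `|x| <= 1.
Proof.
split=> [/(le_re H)|x1]; first by rewrite re1.
by rewrite /unit_ball /= norm_re -(rmorph1 iota) le_iota.
Qed.

Lemma unit_sphereE x : unit_sphere x <-> re `|x| = 1.
Proof.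
split=> [->|x1]; first by rewrite re1.
by rewrite /unit_sphere /= norm_re x1 rmorph1.
Qed.

End Norm.

Context (X : normedModType K).
Local Notation functional := {linear X -> K^o}.
Implicit Types (x y : X) (f g h u : functional) (a c d e r s t : R).
Local Notation nrm x := (re `|x|).
Local Notation dnorm := (@dual_norm R K re X).

(** * The dual norm and real perturbations of functionals *)

Definition perturb (a : R) (f h : functional) : functional :=
  [the functional of (f \+ (iota a \*: h))].

Lemma perturbE a f h x : perturb a f h x = f x + iota a * h x.
Proof. by []. Qed.

Lemma dual_perturb a f h : dual f -> dual h -> dual (perturb a f h).
Proof.
move=> fc hc x.
rewrite /continuous_at /=.
apply: cvgD; first exact: fc.
apply: cvgZr; exact: hc.
Qed.

(** Since [sup] is 0 on unbounded sets, this bound is what makes [dual_norm] a genuine supremum on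
    continuous functionals. *)
Lemma dual_bounded f : dual f ->
  has_ubound [set nrm (f x) | x in @unit_ball K X].
Proof.
move=> fc.
have /linear_boundedP : bounded_near f (nbhs (0:X)).
  apply: continuous_linear_bounded; exact: fc.
move=> /pinfty_ex_gt0[r r0 fr].
exists (re r) => _ [x /= x1 <-].
apply: (le_re H).
apply: le_trans (fr x) _.
by rewrite ler_piMr// ltW.
Qed.

Lemma unit_ball0 : unit_ball (0 : X).
Proof. by apply/unit_ballE; rewrite normr0 re0. Qed.

Lemma dual_norm_ub f x : dual f -> unit_ball x -> nrm (f x) <= dnorm f.
Proof.
move=> fc x1; apply: ub_le_sup; first exact: dual_bounded.
by exists x.
Qed.

(** Stated for bare maps so that it applies to differences [f \- g]. *)
Lemma dual_norm_le (u : X -> K^o) a :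
  (forall x, unit_ball x -> nrm (u x) <= a) -> dnorm u <= a.
Proof.
move=> ua; apply: ge_sup => [|_ [x x1 <-]]; last exact: ua.
by exists (nrm (u 0)), 0 => //; exact: unit_ball0.
Qed.

Lemma dual_norm_ge0 f : dual f -> 0 <= dnorm f.
Proof.
by move=> fc; apply: le_trans (dual_norm_ub fc unit_ball0); rewrite re_norm_ge0.
Qed.

Lemma dual_norm_perturb a f h : dual f -> dual h ->
  dnorm (perturb a f h) <= dnorm f + `|a| * dnorm h.
Proof.
move=> fc hc; apply: dual_norm_le => x x1.
apply: le_trans (re_normD (_ : K^o) _) _.
apply: lerD; first exact: dual_norm_ub.
rewrite (re_normZ (V := K^o)) ler_wpM2l//; exact: dual_norm_ub.
Qed.

Lemma dual_dist_perturb a f h : dual h ->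
  dnorm (f \- perturb a f h) <= `|a| * dnorm h.
Proof.
move=> hc; apply: dual_norm_le => x x1 /=.
rewrite opprD addrA subrr add0r normrN (re_normZ (V := K^o)).
by rewrite ler_wpM2l//; exact: dual_norm_ub.
Qed.

Lemma dual_distD f g h : dual f -> dual g -> dual h ->
  dnorm (f \- h) <= dnorm (f \- g) + dnorm (g \- h).
Proof.
move=> fc gc hc; apply: dual_norm_le => x x1 /=.
have bnd (u v : functional) : dual u -> dual v -> nrm (u x - v x) <= dnorm (u \- v).
  move=> uc vc; apply: ub_le_sup; last by exists x.
  have [a ua] := dual_bounded uc; have [b vb] := dual_bounded vc.
  exists (a + b) => _ [y /= y1 <-].
  apply: le_trans (re_normD (_ : K^o) _) _; rewrite normrN.
  by apply: lerD; [apply: ua|apply: vb]; exists y.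
rewrite -[f x](subrK (g x)) -addrA.
apply: le_trans (re_normD (_ : K^o) _) _.
by apply: lerD; exact: bnd.
Qed.

Lemma dual_dist_refl f : dnorm (f \- f) = 0.
Proof.
have z0 : dnorm (f \- f) <= 0.
  by apply: dual_norm_le => x _ /=; rewrite subrr normr0 re0.
apply/eqP; rewrite eq_le z0 /=.
apply: ub_le_sup.
  by exists 0 => _ [x _ <-] /=; rewrite subrr normr0 re0.
by exists 0; [exact: unit_ball0|rewrite /= subrr normr0 re0].
Qed.

(** * Improving a pair by a small move *)

Lemma dual_norm_approx f e : dual f -> 0 < e ->
  exists2 x, unit_ball x & dnorm f - e <= re (f x).
Proof.
move=> fc e0.
have [|_ [x x1 <-] /ltW xe] := sup_adherent e0 (E := [set nrm (f x) | x in @unit_ball K X]).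
  split; last exact: dual_bounded.
  by exists (nrm (f 0)), 0 => //; exact: unit_ball0.
have [fx0|fx0] := eqVneq (f x) 0.
  exists x => //; rewrite fx0; move: xe; rewrite fx0.
  by rewrite normr0.
(* Rotating [x] by a scalar of modulus 1 turns the value of [f] into its absolute value. *)
exists ((`|f x| / f x) *: x).
  rewrite /unit_ball /= normrZ normrM normfV normr_id divff ?normr_eq0//.
  by rewrite mul1r.
rewrite linearZ /=.
by rewrite /GRing.scale /= divfK.
Qed.

(** Slide [x] by the fraction [t] of the segment to a point [w] of the ball that norms [f] up to
    [e]. *)
Lemma unit_ball_move f x t e : dual f -> unit_ball x -> 0 <= t <= 1 -> 0 < e ->
  exists y, [/\ unit_ball y, nrm (x - y) <= 2 * t &
    re (f x) + t * (dnorm f - e - re (f x)) <= re (f y)].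
Proof.
move=> fc x1 /andP[t0 t1] e0.
have [w w1 fw] := dual_norm_approx fc e0.
exists (iota (1 - t) *: x + iota t *: w).
move: x1 w1 => /unit_ballE x1 /unit_ballE w1; split.
- apply/unit_ballE; apply: le_trans (re_normD _ _) _.
  rewrite !re_normZ !ger0_norm ?subr_ge0//.
  nra.
- have -> : x - (iota (1 - t) *: x + iota t *: w) = iota t *: (x - w).
    rewrite rmorphB rmorph1 scalerBl scale1r scalerBr.
    by rewrite opprD opprB addrA addrC addrA addrACA subrr addr0 addrC.
  rewrite re_normZ ger0_norm// mulrC ler_wpM2r//.
  apply: le_trans (re_normD _ _) _; rewrite normrN; lra.
- rewrite linearD !linearZ /= (reD H) /GRing.scale /= !(reM H).
  nra.
Qed.

(* A functional with some room inside the dual ball may lie (nearly) in the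
   kernel of evaluation at [x], where moving [x] or [f] alone gains nothing to
   first order; adding [+- s u] first produces a functional of norm at least
   [s / 2] without decreasing the value at [x]. *)
Lemma dual_nondegenerate u f x s : dual u -> dnorm u = 1 -> dual f -> 0 <= s ->
  exists h, [/\ dual h, dnorm h <= dnorm f + s, dnorm (f \- h) <= s,
    re (f x) <= re (h x) & s / 2 <= dnorm h].
Proof.
move=> uc u1 fc s0.
have [fs|fs] := leP (s / 2) (dnorm f).
  by exists f; split=> //; [lra|rewrite dual_dist_refl].
(* The sign of [a] is chosen so that adding [a u] does not lower the value at [x]. *)
have [a as_ aux] : exists2 a, `|a| = s & 0 <= a * re (u x).
  have [ux|ux] := leP 0 (re (u x)); first by exists s; [rewrite ger0_norm//|nra].
  by exists (- s); [rewrite normrN ger0_norm//|nra].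
exists (perturb a f u); split.
- exact: dual_perturb.
- by have := dual_norm_perturb a fc uc; rewrite as_ u1 mulr1.
- by have := dual_dist_perturb a f uc; rewrite as_ u1 mulr1.
- by rewrite perturbE (reD H) (reM H); lra.
(* Triangle inequality for [a u = (f + a u) - f], where [f] has norm below [s / 2]. *)
- suff : s <= dnorm f + dnorm (perturb a f u) by lra.
  rewrite -[leLHS]mulr1 -{1}u1 -as_.
  have [->|a0] := eqVneq a 0.
    by rewrite normr0 mul0r addr_ge0// dual_norm_ge0//; exact: dual_perturb.
  rewrite mulrC -ler_pdivlMr ?normr_gt0//.
  apply: dual_norm_le => y y1.
  rewrite ler_pdivlMr ?normr_gt0// mulrC -(re_normZ (V := K^o)).
  have -> : iota a *: (u y : K^o) = perturb a f u y - f y.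
    by rewrite perturbE addrC addKr.
  apply: le_trans (re_normD (_ : K^o) _) _; rewrite normrN addrC.
  by apply: lerD; apply: dual_norm_ub => //; exact: dual_perturb.
Qed.

Lemma ball_improvement u x f c s : dual u -> dnorm u = 1 ->
  unit_ball x -> dual_ball re f -> 0 < s -> 2 * s <= c -> c <= 1 ->
  re (f x) <= 1 - 2 * c ->
  exists y g, [/\ unit_ball y, dual_ball re g, nrm (x - y) <= 2 * s,
    dnorm (f \- g) <= 2 * s & re (f x) + s ^+ 2 / 8 <= re (g y)].
Proof.
move=> uc u1 x1 [fc f1] s0 sc c1 fx.
have s01 : 0 <= s <= 1 by apply/andP; split; lra.
have [fc1|fc1] := leP (1 - c) (dnorm f).
  have c20 : 0 < c / 2 by lra.
  have [y [y1 xy fy]] := unit_ball_move fc x1 s01 c20.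
  exists y, f; split=> //; first by rewrite dual_dist_refl; lra.
  (* The gain is at least [s * c / 2], hence at least [s ^+ 2]. *)
  apply: le_trans fy; nra.
have [h [hc hf fh fhx h2]] := dual_nondegenerate x uc u1 fc (ltW s0).
have [hx|hx] := leP (s / 8) (re (h x)).
  exists x, (perturb s h h).
  have gh : dnorm (perturb s h h) <= (1 + s) * dnorm h.
    by have := dual_norm_perturb s hc hc; rewrite gtr0_norm// mulrDl mul1r.
  have hg : dnorm (h \- perturb s h h) <= s * dnorm h.
    by have := dual_dist_perturb s h hc; rewrite gtr0_norm.
  split=> //.
  (* As [2 * s <= c], [h] has norm at most [1 - s], and [(1 + s) * (1 - s) <= 1]. *)
  - split; first exact: dual_perturb.
    apply: le_trans gh _; nra.
  - by rewrite subrr normr0 re0; lra.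
  - apply: le_trans (dual_distD fc hc (dual_perturb hc hc)) _; nra.
  - by rewrite perturbE (reD H) (reM H); nra.
have s80 : 0 < s / 8 by lra.
have [y [y1 xy hy]] := unit_ball_move hc x1 s01 s80.
exists y, h; split=> //; [by split=> //; lra|lra|].
(* The gain is at least [s * (s / 2 - s / 8 - s / 8)]. *)
apply: le_trans hy; nra.
Qed.

(** Moving towards [w] gains at least [s * (1 - c)] before [re (f x)] is added up, while normalising
    changes the value by a factor between [1 / (1 + s)] and [1 / (1 - s)]; the two-sided bound on
    [re (f x)] keeps that loss smaller. *)
Lemma sphere_improvement x f c s :
  unit_sphere x -> dual_sphere re f -> 0 < c -> 0 < s -> s <= 1 / 2 ->
  `|re (f x)| <= 1 - 2 * c ->
  exists y, [/\ unit_sphere y, nrm (x - y) <= 2 * s &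
    re (f x) + s * c / 2 <= re (f y)].
Proof.
move=> /unit_sphereE x1 [fc f1] c0 s0 s2; rewrite ler_norml => /andP[fx1 fx2].
have [w /unit_ballE w1 fw] := dual_norm_approx fc c0.
pose v := x + iota s *: w; pose n := nrm v.
have sw : nrm (iota s *: w) <= s by rewrite re_normZ gtr0_norm//; nra.
have xv : nrm (x - v) <= s by rewrite /v opprD addrA subrr add0r normrN.
have n1 : n <= 1 + s by apply: le_trans (re_normD _ _) _; lra.
have n2 : 1 - s <= n.
  by have := re_normD (x - v) v; rewrite subrK x1 -/n; lra.
have n0 : 0 < n by lra.
have fv : re (f x) + s * (1 - c) <= re (f v).
  rewrite /v linearD linearZ /= (reD H) /GRing.scale /= (reM H).
  by rewrite f1 in fw; nra.
exists (iota n^-1 *: v); split.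
- by apply/unit_sphereE; rewrite re_normZ gtr0_norm ?invr_gt0// mulVf// gt_eqF.
- suff vn : nrm (v - iota n^-1 *: v) <= s.
    by have := re_normD (x - v) (v - iota n^-1 *: v); rewrite addrA subrK; lra.
  rewrite -[X in X - _](scale1r v) -(rmorph1 iota) -scalerBl -rmorphB re_normZ.
  rewrite -/n -{2}(gtr0_norm n0) -normrM mulrBl mul1r mulVf ?gt_eqF//.
  by rewrite ler_norml; apply/andP; split; lra.
- rewrite linearZ /= /GRing.scale /= (reM H) [leRHS]mulrC ler_pdivlMr//.
  apply: le_trans fv.
  have sc0 : 0 < s * c by rewrite mulr_gt0.
  have sc1 : 0 <= s * c * (1 - s) by apply: mulr_ge0; lra.
  have sfx1 : 0 <= s * (1 - 2 * c - re (f x)) by apply: mulr_ge0; lra.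
  have sfx2 : 0 <= s * (1 - 2 * c + re (f x)) by apply: mulr_ge0; lra.
  (* The sign decides which of [n <= 1 + s] and [1 - s <= n] is the worst case. *)
  have [b0|b0] := leP 0 (re (f x) + s * c / 2).
    apply: (@le_trans _ _ ((re (f x) + s * c / 2) * (1 + s))); last by lra.
    by rewrite ler_wpM2l.
  apply: (@le_trans _ _ ((re (f x) + s * c / 2) * (1 - s))); last by nra.
  by rewrite ler_wnM2l// ltW.
Qed.

(** * From improvement of pairs to continuity of the modulus *)

Section Continuity.
Context (A : set (X * functional)).
Context (A_ball : A `<=` @unit_ball K X `*` @dual_ball R K re X).

(* Norming pairs always exist by the Hahn-Banach theorem, but this is not
   needed: without them the modulus would be constantly 0, as the infimum of all
   positive reals or of the empty set. *)
Context (A_improvement : norming_pairs (X := X) re !=set0 ->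
  forall d e, 0 < d < 2 -> 0 < e -> exists2 r, 0 < r &
  forall x f, A (x, f) -> 1 - (d + r) < re (f x) ->
  exists y g, [/\ A (y, g), 1 - (d - r) < re (g y), nrm (x - y) <= e &
    dnorm (f \- g) <= e]).

Local Notation M := (bpb_modulus_on re A).

Lemma bpb_approximableS d d' e : d <= d' ->
  bpb_approximable re A d' e -> bpb_approximable re A d e.
Proof. by move=> dd h x f Axf dfx; apply: h Axf _; lra. Qed.

Lemma bpb_modulus_on_le d e : 0 < e -> bpb_approximable re A d e -> M d <= e.
Proof. by move=> e0 Ae; apply: ge_inf; first by exists 0 => b /= [/ltW]. Qed.

Lemma bpb_modulus_on_empty d : ~ (norming_pairs (X := X) re !=set0) -> M d = 0.
Proof.
move=> N0; rewrite /bpb_modulus_on.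
have [Ad|Ad] := pselect (forall e, bpb_approximable re A d e).
  apply/eqP; rewrite eq_le; apply/andP; split.
    apply/ler_addgt0Pr => e e0; rewrite add0r.
    exact: bpb_modulus_on_le.
  apply: lb_le_inf; first by exists 1; split; [exact: ltr01|].
  by move=> a /= [/ltW].
(* Some pair of [A] would need a norming pair nearby, so no [e] qualifies. *)
rewrite (_ : [set _ | _] = set0) ?inf0//; apply/seteqP; split=> // e [_ Ae].
apply: Ad => e' x f Axf dfx; have [y [g [yg _]]] := Ae x f Axf dfx.
by case: N0; exists (y, g).
Qed.

(** Any 3 > 2 works: 2 bounds the diameters of both unit balls. *)
Lemma bpb_modulus_set_neq0 d : norming_pairs (X := X) re !=set0 ->
  [set e | 0 < e /\ bpb_approximable re A d e] !=set0.
Proof.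
move=> [[y g] yg]; exists 3; split; first by rewrite ltr0n.
move=> x f Axf _; exists y, g; split=> //.
have [/= /unit_ballE x1 [fc f1]] := A_ball Axf.
have [/= /unit_sphereE y1 [[gc g1] _]] := yg.
split.
  by apply: le_lt_trans (re_normD _ _) _; rewrite normrN; lra.
apply: (@le_lt_trans _ _ 2); last by lra.
apply: dual_norm_le => z z1 /=.
apply: le_trans (re_normD (_ : K^o) _) _; rewrite normrN.
have := dual_norm_ub fc z1; have := dual_norm_ub gc z1; lra.
Qed.

Lemma le_bpb_modulus_on d d' : norming_pairs (X := X) re !=set0 ->
  d <= d' -> M d <= M d'.
Proof.
move=> N0 dd; apply: lb_le_inf; first exact: bpb_modulus_set_neq0.
move=> e [e0 Ae]; apply: bpb_modulus_on_le => //; exact: bpb_approximableS Ae.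
Qed.

Lemma bpb_modulus_on_continuous : {within `]0, 2[, continuous (M : R -> R)}.
Proof.
rewrite continuous_open_subspace; last exact: interval_open.
move=> d; rewrite inE /= in_itv /= => d02.
have [N0|N0] := pselect (norming_pairs (X := X) re !=set0); last first.
  have -> : M = cst 0 by apply/funext => t; rewrite bpb_modulus_on_empty.
  exact: cvg_cst.
(* If [a] is admissible at [d - r], then [a + e] is at [d + r]: improve the pair at cost [e], then
   approximate it. *)
apply/cvgrPdist_le => e e0.
have [r r0 Ar] := A_improvement N0 d02 e0.
have Mr : M (d + r) <= M (d - r) + e.
  rewrite -lerBlDr; apply: lb_le_inf; first exact: bpb_modulus_set_neq0.
  move=> a [a0 Aa]; rewrite lerBlDr.
  apply: bpb_modulus_on_le => [|x f Axf dfx]; first by rewrite addr_gt0.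
  have [y [g [Ayg dgy xy fg]]] := Ar x f Axf dfx.
  have [z [h [zh [yz gh]]]] := Aa y g Ayg dgy.
  exists z, h; split=> //.
  have [_ [/= fc _]] := A_ball Axf; have [_ [/= gc _]] := A_ball Ayg.
  have [_ [[/= hc _] _]] := zh.
  split.
    by have := re_normD (x - y) (y - z); rewrite addrA subrK; lra.
  by have := dual_distD fc gc hc; lra.
near=> t.
have tr : `|d - t| <= r.
  near: t; exact: cvgr_dist_le.
move: tr; rewrite ler_norml => /andP[tr1 tr2].
have M1 : M t <= M (d + r) by apply: le_bpb_modulus_on => //; lra.
have M2 : M (d - r) <= M t by apply: le_bpb_modulus_on => //; lra.
have M3 : M d <= M (d + r) by apply: le_bpb_modulus_on => //; lra.
have M4 : M (d - r) <= M d by apply: le_bpb_modulus_on => //; lra.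
by rewrite ler_norml; apply/andP; split; lra.
Unshelve. all: by end_near. Qed.

End Continuity.

(** * Choice of constants for the two moduli *)

Lemma bpb_modulus_continuous : {within `]0, 2[, continuous (bpb_modulus re X)}.
Proof.
apply: bpb_modulus_on_continuous => // -[[v u] [_ [[/= uc u1] _]]] d e.
move=> /andP[d0 d2] e0.
pose s := Num.min (d / 8) (e / 2).
have s0 : 0 < s by rewrite lt_min; apply/andP; split; lra.
have [sd se] : s <= d / 8 /\ s <= e / 2.
  by rewrite /s !ge_min !lexx orbT.
(* Half the gain of [ball_improvement], which has to cover [2 * r]. *)
exists (s ^+ 2 / 16); first by nra.
move=> x f [/= x1 fb] dfx.
have [fx|fx] := leP (re (f x)) (1 - d / 2).
  have [|||y [g [y1 gb xy fg gy]]] := ball_improvement (c := d / 4) uc u1 x1 fb s0; try lra.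
  exists y, g; split=> //; lra.
exists x, f; split=> //; first by nra.
  by rewrite subrr normr0 re0 ltW.
by rewrite dual_dist_refl ltW.
Qed.

Lemma spherical_bpb_modulus_continuous :
  {within `]0, 2[, continuous (spherical_bpb_modulus re X)}.
Proof.
apply: bpb_modulus_on_continuous => [[x f] [/= x1 [fc f1]]|_ d e].
  split; last by split=> //=; rewrite f1.
  by apply/unit_ballE; move/unit_sphereE : x1 => ->.
move=> /andP[d0 d2] e0.
(* The term [(2 - d) / 4] keeps [re (f x)] away from -1; a pair with [re (f x)] above [1 - 2 * c] is
   left unchanged. *)
pose c := Num.min (d / 4) ((2 - d) / 4).
have c0 : 0 < c by rewrite lt_min; apply/andP; split; lra.
have [cd cd2] : c <= d / 4 /\ c <= (2 - d) / 4.
  by rewrite /c !ge_min !lexx orbT.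
pose s := Num.min (1 / 2) (e / 2).
have s0 : 0 < s by rewrite lt_min; apply/andP; split; lra.
have [s2 se] : s <= 1 / 2 /\ s <= e / 2.
  by rewrite /s !ge_min !lexx orbT.
exists (s * c / 4); first by nra.
move=> x f [/= x1 fb] dfx.
have [fx|fx] := leP (re (f x)) (1 - 2 * c).
  have [|y [y1 xy fy]] := sphere_improvement x1 fb c0 s0 s2.
    by rewrite ler_norml fx andbT; nra.
  exists y, f; split=> //; [lra|lra|].
  by rewrite dual_dist_refl ltW.
exists x, f; split=> //; first by nra.
  by rewrite subrr normr0 re0 ltW.
by rewrite dual_dist_refl ltW.
Qed.

End Modulus.

(** * Real and complex scalars *)

Lemma real_part_real (R : realType) : real_part (idfun : R -> R) idfun.
Proof. by split. Qed.

Lemma real_part_complex (R : realType) :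
  real_part (@complex.Re R) (real_complex R).
Proof.
split.
- by case=> [a b] [c d].
- by move=> a [c d] /=; rewrite mul0r subr0.
- by move=> x /ger0_real/RRe_real.
- by move=> a; rewrite lecR.
- by move=> x y; rewrite lecE => /andP[].
Qed.

Theorem proposition3p1 (R : realType) :
  (forall X : completeNormedModType R, (exists x : X, x != 0) ->
     {within `]0, 2[, continuous (bpb_modulus idfun X : R -> R)} /\
     {within `]0, 2[, continuous (spherical_bpb_modulus idfun X : R -> R)}) /\
  (forall X : completeNormedModType R[i], (exists x : X, x != 0) ->
     {within `]0, 2[, continuous (bpb_modulus (@complex.Re R) X : R -> R)} /\
     {within `]0, 2[,
        continuous (spherical_bpb_modulus (@complex.Re R) X : R -> R)}).
Proof.
split=> X _; split.
- exact: (bpb_modulus_continuous (real_part_real R)).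
- exact: (spherical_bpb_modulus_continuous (real_part_real R)).
- exact: (bpb_modulus_continuous (real_part_complex R)).
- exact: (spherical_bpb_modulus_continuous (real_part_complex R)).
Qed.
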